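(* Let $\mathbb{F}_q$ be a finite field with $q$ elements, $q$ odd, and let $G=\mathrm{GL}_2(\mathbb{F}_q)$. (a) Let $V=\mathrm{Ind}_B^G B_0=G_0\oplus V_q$ be the $G$-module over $\mathbb{C}$ induced from the trivial module $B_0$ of the Borel subgroup $B$ of upper-triangular matrices in $G$. Then $$\dim (V^{\otimes k})^G=\begin{cases}1&\text{when }k=0,\\ \dfrac{1}{q(q-1)}\left((q+1)^{k-1}+q(q-2)\cdot2^{k-1}+q-1\right)&\text{when }k\ge1.\end{cases}$$ The Poincaré series for the $G$-invariants in $\bigoplus_{k\ge0}V^{\otimes k}$ is $$\sum_{k=0}^\infty\dim (V^{\otimes k})^G\,t^k=\frac{1-(q+3)t+(2q+3)t^2-qt^3}{(1-t)(1-2t)(1-(1+q)t)}.$$ (b) For the Steinberg module $V_q$, $\dim (V_q^{\otimes k})^G=1$ when $k=0$, and when $k\ge1$, $$\dim (V_q^{\otimes k})^G=\frac1{2(q^2-1)}\left(2q^{k-1}-q(q-1)(-1)^{k-1}+(q+1)(q-2)\right)$$ $$=\begin{cases}\dfrac{q^{2\ell}-1}{q^2-1}=\displaystyle\sum_{j=0}^{\ell-1}q^{2j}&\text{if }k=2\ell+1\ge1,\\[8pt] 1+q\,\dfrac{q^{2\ell-2}-1}{q^2-1}=1+\displaystyle\sum_{j=0}^{\ell-2}q^{2j+1}&\text{if }k=2\ell\ge2.\end{cases}$$ The Poincaré series for the $G$-invariants in $\bigoplus_{k\ge0}V_q^{\otimes k}$ is $$\sum_{k=0}^\infty\dim (V_q^{\otimes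 k})^G\,t^k=\frac{1-qt+t^3}{(1-t)(1+t)(1-qt)}.$$
   Context: $G_0$ denotes the trivial one-dimensional complex $G$-module. The induced module $V=\mathbb{C}[G]\otimes_{\mathbb{C}[B]}B_0$ has dimension $q+1$ and decomposes as $V=G_0\oplus V_q$, where $V_q$ is an irreducible $q$-dimensional $G$-module, the Steinberg module. For a $G$-module $W$, $W^G$ is its space of $G$-invariants. Empty sums are $0$. *)

(* Defs.v *)
From HB Require Import structures.
From mathcomp Require Import all_boot all_order all_algebra all_fingroup.
From mathcomp Require Import all_solvable all_field all_character.

Set Implicit Arguments.
Unset Strict Implicit.
Unset Printing Implicit Defensive.

Import Order.TTheory GRing.Theory Num.Theory.
Local Open Scope ring_scope.

(* Matrix representations are read as in mxrepresentation: g acts on row      *)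
(* vectors on the right, v |-> v *m rG g. A left module W is turned into such *)
(* a right module by w g := g^-1 w, so that K[G] (x)_K[H] W is read as        *)
(* W (x)_K[H] K[G].                                                           *)

Section GroupModules.

Variables (K : fieldType) (gT : finGroupType).

Lemma triv_mx_repr (G : {group gT}) n :
  mx_repr G (fun _ : gT => 1%:M : 'M[K]_n).
Proof. by split=> // x y _ _; rewrite mulmx1. Qed.

Definition triv_repr (G : {group gT}) n : mx_representation K G n :=
  MxRepresentation (triv_mx_repr G n).

Definition triv_grepr (G : {group gT}) : representation K G :=
  Representation (triv_repr G 1).

Fixpoint tensor_power (G : {group gT}) (V : representation K G) (k : nat) :
    representation K G :=
  if k is k'.+1 then Representation (prod_repr V (tensor_power V k'))
  else triv_grepr G.

Definition dim_invariants (G : {group gT}) (V : representation K G) : nat :=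
  \rank (rfix_mx V G).

Definition tensor_inv_dim (G : {group gT}) (V : representation K G) (k : nat) :=
  dim_invariants (tensor_power V k).

(* The coefficient sequence of the Poincare series of the tensor algebra. *)
Definition poincare_series (G : {group gT}) (V : representation K G) :
    nat -> rat :=
  fun k => (tensor_inv_dim V k)%:R.

Section Induction.

Variables (G H : {group gT}) (sHG : H \subset G) (W : representation K H).

(* Left multiplication by h on the basis of the group ring used by            *)
(* regular_repr, whose own matrices are the right multiplications.            *)
Definition left_mult_mx (h : gT) : 'M[K]_(gcard G) :=
  \matrix_i delta_mx 0 (gring_index G (h * enum_val i)%g).

(* Its rows span the vectors w h (x) x - w (x) h x, for w in W and x in G.    *)
Definition balance_mx (h : gT) : 'M[K]_(rdegree W * gcard G) :=
  tprod (W h) 1%:M - tprod 1%:M (left_mult_mx h).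

Definition balance_relations : 'M[K]_(rdegree W * gcard G) :=
  (\sum_(h in H) balance_mx h)%MS.

(* W (x)_K K[G], where G acts on the second factor only. *)
Definition free_repr : mx_representation K G (rdegree W * gcard G) :=
  prod_repr (triv_repr G (rdegree W)) (regular_repr K G).

Lemma left_mult_mxC h x : h \in H -> x \in G ->
  left_mult_mx h *m regular_repr K G x = regular_repr K G x *m left_mult_mx h.
Proof.
move=> Hh Gx; have Gh := subsetP sHG h Hh.
apply/row_matrixP=> i; rewrite !row_mul !rowK -!rowE !rowK.
by rewrite !gring_indexK ?groupM ?enum_valP // mulgA.
Qed.

Lemma balance_relations_module : mxmodule free_repr balance_relations.
Proof.
apply: sumsmx_module => h Hh; apply/mxmoduleP=> x Gx.
have ->: balance_mx h *m free_repr x = free_repr x *m balance_mx h.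
  rewrite mulmxBl mulmxBr -!tprodE !mulmx1 !mul1mx.
  by rewrite left_mult_mxC.
by rewrite mulmx_sub // (sumsmx_sup h).
Qed.

Definition induced : representation K G :=
  Representation (factmod_repr balance_relations_module).

End Induction.

End GroupModules.

Section GL2.

Variables (K : fieldType) (F : finFieldType).

Definition borel_set : {set {'GL_2[F]}} :=
  [set g : {'GL_2[F]} | GLval g ord_max ord0 == 0].

Lemma borel_group_set : group_set borel_set.
Proof.
apply/group_setP; split=> [|x y]; first by rewrite inE mxE.
rewrite !inE => /eqP x10 /eqP y10; rewrite (GL_MxE x y) mxE big_ord_recl big_ord1.
rewrite (_ : lift _ _ = ord_max) ?y10 ?mulr0 ?addr0; last exact: val_inj.
by rewrite x10 mul0r.
Qed.

Canonical borel := Group borel_group_set.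

Lemma borel_sub : borel \subset 'GL_2[F]%g.
Proof. by apply/subsetP=> x _; rewrite inE. Qed.

Definition borel_induced : representation K 'GL_2[F]%G :=
  induced borel_sub (triv_grepr K borel).

(* By the Krull-Schmidt theorem this determines Vq up to isomorphism; its     *)
(* irreducibility and its dimension #|F| are then consequences.               *)
Definition is_steinberg (Vq : representation K 'GL_2[F]%G) : Prop :=
  mx_rsim borel_induced (dadd_grepr (triv_grepr K _) Vq).

Lemma fixed_vector_rsim_triv (gT : finGroupType) (G : {group gT}) n
    (rG : mx_representation K G n) (U : 'M_n) (modU : mxmodule rG U) :
  \rank U = 1%N -> (U <= rfix_mx rG G)%MS ->
  mx_rsim (submod_repr modU) (triv_grepr K G).
Proof.
move=> rU fixU; exists (const_mx 1) => //=.
  rewrite /row_free rU eqn_leq rank_leq_col lt0n mxrank_eq0.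
  apply/eqP=> /matrixP/(_ 0 0); rewrite !mxE => /eqP.
  by rewrite oner_eq0.
move=> x Gx; rewrite /= mulmx1; suff ->: submod_mx modU x = 1%:M by rewrite mul1mx.
have /rfix_mxP fixU1: (val_submod (1%:M : 'M_(\rank U)) <= rfix_mx rG G)%MS.
  by rewrite (submx_trans (val_submodP _)).
by rewrite /submod_mx fixU1 // val_submodK.
Qed.

End GL2.

Lemma steinberg_exists (K : numFieldType) (F : finFieldType) :
  exists Vq : representation K 'GL_2[F]%G, is_steinberg Vq.
Proof.
set V := borel_induced K F; pose nG := gcard 'GL_2[F]%G.
pose v0 : 'M[K]_(1 * 1, 1 * nG) := tprod (1%:M : 'M_1) (const_mx 1 : 'rV_nG).
pose au : 'M[K]_(1 * nG, 1 * 1) := tprod (1%:M : 'M_1) (const_mx 1 : 'cV_nG).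
set R := balance_relations 'GL_2[F]%G (triv_grepr K (borel F)).
have Rau : R *m au = 0.
  apply/sub_kermxP/sumsmx_subP=> h Bh; apply/sub_kermxP.
  rewrite mulmxBl -!tprodE !mul1mx.
  apply/eqP; rewrite subr_eq0; apply/eqP; congr tprod.
  apply/row_matrixP=> i; rewrite row_mul rowK -rowE.
  by apply/rowP=> j; rewrite !mxE.
have v0au : v0 *m au != 0.
  apply/eqP=> /(congr1 mxtrace); rewrite -tprodE mxtrace_prod mulmx1 mxtrace1.
  rewrite mul1r raddf0 => /eqP.
  rewrite /mxtrace big_ord1 !mxE (eq_bigr (fun _ => 1)) => [|i _]; last first.
    by rewrite !mxE mulr1.
  by rewrite sumr_const card_ord pnatr_eq0 eqn0Ngt cardG_gt0.
pose w := in_factmod R v0.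
have w_neq0 : w != 0.
  rewrite in_factmod_eq0; apply: contra v0au => /submxP[D ->].
  by rewrite -mulmxA Rau mulmx0.
have fixw : (w <= rfix_mx V 'GL_2[F]%g)%MS.
  apply/rfix_mxP=> x Gx.
  rewrite -in_factmodJ //; congr (in_factmod _ _).
  rewrite -tprodE mulmx1; congr tprod.
  apply/rowP=> j; rewrite !mxE.
  rewrite (bigD1 (gring_index 'GL_2[F] (enum_val j * x^-1)%g)) //=.
  rewrite !mxE gring_indexK ?groupM ?groupV ?enum_valP // mulgKV gring_valK.
  rewrite !eqxx mul1r big1 ?addr0 // => i neq_i.
  rewrite !mxE mul1r eqxx /=; case: eqP => // def_j; case/eqP: neq_i.
  by rewrite def_j gring_indexK ?groupM ?enum_valP // mulgK gring_valK.
have modw : mxmodule V <<w>>%MS.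
  apply/mxmoduleP=> x Gx; rewrite (eqmxMr _ (genmxE w)) genmxE.
  by have /rfix_mxP -> := fixw.
have rw : \rank <<w>>%MS = 1%N.
  apply/eqP; rewrite genmxE eqn_leq rank_leq_row lt0n mxrank_eq0.
  exact: w_neq0.
have G0 : ([pchar K]^'.-group 'GL_2[F])%g.
  by apply/pgroupP=> p _; rewrite inE /= pchar_num.
have [U modU defU dxU] := mx_Maschke_pchar V G0 modw (submx1 _).
exists (Representation (submod_repr modU)).
have mod1 := mxmodule1 V.
apply: mx_rsim_trans (mx_rsim_sym (rsim_submod1 mod1 (eqmx_refl _))) _.
apply: (mx_rsim_dadd (modU := modw) (modV := modU) mod1 defU dxU); last first.
  exact: mx_rsim_refl.
by apply: fixed_vector_rsim_triv; rewrite // genmxE.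
Qed.

Section FormalPowerSeries.

Variable K : fieldType.

Definition fps_mul (f g : nat -> K) (n : nat) : K :=
  \sum_(i < n.+1) f i * g (n - i)%N.

(* f = p / q in the ring of formal power series, where q is a unit if and     *)
(* only if its constant coefficient is nonzero.                               *)
Definition fps_eq_frac (f : nat -> K) (p q : {poly K}) : Prop :=
  q`_0 != 0 /\ forall n, fps_mul f (fun i => q`_i) n = p`_n.

End FormalPowerSeries.

(* Main.v *)
(* The number of invariants is the average of the characters. As V is induced *)
(* from the trivial module of B, Frobenius reciprocity gives, with chi the    *)
(* character of V,                                                            *)
(*   dim (V^(k+1))^G = |B|^-1 sum_(b in B) chi(b)^k,                          *)
(* where chi(b) = |B|^-1 #{x | x b x^-1 in B} is q + 1 if b is scalar, 1 if b *)
(* is a nonscalar matrix with equal eigenvalues, and 2 otherwise. For the     *)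
(* Steinberg character chi - 1 the same argument applied to                   *)
(* chi (chi - 1)^k = (chi - 1)^(k+1) + (chi - 1)^k gives the recursion        *)
(*   dim (Vq^(k+1))^G + dim (Vq^k)^G = |B|^-1 sum_(b in B) (chi(b) - 1)^k.    *)

Require Import Defs.
From mathcomp Require Import all_boot all_order all_algebra all_fingroup.
From mathcomp Require Import all_character.
From mathcomp Require Import reals complex ring.

Set Implicit Arguments.
Unset Strict Implicit.
Unset Printing Implicit Defensive.

Import Order.TTheory GRing.Theory Num.Theory.
Local Open Scope ring_scope.

(** V is the permutation module on the projective line, so its character [chi] counts fixed points.
    Invariants of a tensor power are counted by averaging a power of the character
    ([tensor_inv_dimE]), and an average over G with a factor [chi] becomes an average over B
    ([sum_induced_triv_comp]), where [chi] only takes the values q + 1, 1 and 2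
    ([mxtrace_borel_induced]). This settles V. The powers of the Steinberg character [chi - 1] lack
    that factor, but the sum of two consecutive powers has it, which gives a two-term recursion
    ([tensor_inv_dim_steinberg]).

    From k = 1 on, each closed form combines three geometric sequences, whose ratios are the inverse
    roots of the denominator of the Poincare series; the exceptional value at k = 0 makes the
    numerator cubic ([cubic_fps_eq_frac]). *)

Lemma mxtrace_idempotent (K : fieldType) n (P : 'M[K]_n) :
  P *m P = P -> \tr P = (\rank P)%:R.
Proof.
move=> PP.
(* In the full-rank factorization P = C R, idempotence cancels to R C = 1, an identity matrix whose
   size is the rank. *)
suff RC: row_base P *m col_base P = 1%:M.
  by rewrite -[in LHS](mulmx_base P) mxtrace_mulC RC mxtrace1.
apply: (row_free_inj (row_base_free P)); apply: (row_full_inj (col_base_full P)).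
move: (mulmx_base P); move: (col_base P) (row_base P) => C R CR.
by rewrite /= mul1mx !mulmxA CR -mulmxA CR.
Qed.

(** * Dimensions of invariants as averages of traces *)

Section Traces.

Variables (K : numFieldType) (gT : finGroupType).

Lemma card_group_neq0 (G : {group gT}) : #|G|%:R != 0 :> K.
Proof. by rewrite pnatr_eq0 eqn0Ngt cardG_gt0. Qed.

(** The averaging operator [P] is idempotent with image the invariants, so its trace is their
    dimension. *)
Lemma dim_invariantsE (G : {group gT}) (V : representation K G) :
  #|G|%:R * (dim_invariants V)%:R = \sum_(g in G) \tr (V g).
Proof.
pose P := #|G|%:R^-1 *: \sum_(g in G) V g : 'M[K]_(rdegree V).
have PV g : g \in G -> P *m V g = P.
  move=> Gg; rewrite /P -scalemxAl mulmx_suml; congr (_ *: _).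
  rewrite [RHS](reindex_inj (mulIg g)) /=.
  apply: eq_big => [h | h Gh]; first by rewrite groupMr.
  by rewrite repr_mxM.
have fixP m (W : 'M_(m, _)) : (W <= rfix_mx V G)%MS -> W *m P = W.
  move/rfix_mxP=> fixW; rewrite /P -scalemxAr mulmx_sumr (eq_bigr (fun _ => W)) //.
  by rewrite sumr_const -scaler_nat scalerA mulVf ?scale1r ?card_group_neq0.
have eqP : (P == rfix_mx V G)%MS.
  apply/andP; split; first by apply/rfix_mxP.
  by rewrite -[X in (X <= _)%MS](fixP _ _ (submx_refl _)) submxMl.
have PP : P *m P = P by apply: fixP; case/andP: eqP.
have := mxtrace_idempotent PP; rewrite (eqmxP eqP) /dim_invariants => <-.
by rewrite mxtraceZ raddf_sum mulrA divff ?mul1r ?card_group_neq0.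
Qed.

Lemma mxtrace_tensor_power (G : {group gT}) (V : representation K G) k g :
  \tr (tensor_power V k g) = \tr (V g) ^+ k.
Proof.
elim: k => [|k IHk] /=; first by rewrite mxtrace1.
by rewrite mxtrace_prod IHk exprS.
Qed.

Lemma tensor_inv_dimE (G : {group gT}) (V : representation K G) k :
  #|G|%:R * (tensor_inv_dim V k)%:R = \sum_(g in G) \tr (V g) ^+ k.
Proof.
by rewrite dim_invariantsE; apply: eq_bigr => g _; rewrite mxtrace_tensor_power.
Qed.

(* C D is a projection along the kernel U; so is e, hence C D e = e and       *)
(* e C D = C D, and the trace does not distinguish them.                      *)
Lemma mxtrace_factmod (G : {group gT}) n (rG : mx_representation K G n)
    (U e : 'M_n) (modU : mxmodule rG U) g :
  (1%:M - e <= U)%MS -> U *m e = 0 -> g \in G -> e *m rG g = rG g *m e ->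
  \tr (factmod_repr modU g) = \tr (e *m rG g).
Proof.
move=> sU Ue0 Gg eg.
pose C := in_factmod U (1%:M : 'M_n).
pose D := val_factmod (1%:M : 'M_(\rank (cokermx U))).
have inE m (W : 'M_(m, n)) : in_factmod U W = W *m C.
  by rewrite /C /in_factmod /= mul1mx.
have DC : D *m C = 1%:M by rewrite -inE val_factmodK.
have UC (W : 'M_n) : (W <= U)%MS -> W *m C = 0.
  by rewrite -in_factmod_eq0 inE => /eqP.
have eCD : e *m (C *m D) = C *m D.
  apply/eqP; rewrite eq_sym -subr_eq0 -{1}[C *m D]mul1mx -mulmxBl mulmxA UC //.
  by rewrite mul0mx.
have CDe : C *m D *m e = e.
  apply/eqP; rewrite eq_sym -subr_eq0 -{1}[e]mul1mx -mulmxBl.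
  have /submxP[A ->] : (1%:M - C *m D <= U)%MS.
    by rewrite -in_factmod_eq0 inE mulmxBl mul1mx -mulmxA DC mulmx1 subrr.
  by rewrite -mulmxA Ue0 mulmx0.
rewrite /= /factmod_mx inE -/D; move: eCD CDe eg; clear.
move: (rG g) C D => X C D eCD CDe eX.
rewrite -mulmxA mxtrace_mulC -mulmxA mxtrace_mulC.
by rewrite -eCD -!mulmxA mxtrace_mulC -!mulmxA -eX !mulmxA CDe.
Qed.

End Traces.

(** * The character induced from a trivial module, and reciprocity *)

Section Induced.

Variables (K : numFieldType) (gT : finGroupType) (G H : {group gT}).
Hypothesis sHG : H \subset G.

Let L := left_mult_mx K G.

Lemma left_mult_mxM h1 h2 : h1 \in G -> h2 \in G ->
  L h1 *m L h2 = L (h2 * h1)%g.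
Proof.
move=> Gh1 Gh2; apply/row_matrixP=> i; rewrite row_mul !rowK -rowE rowK.
by rewrite gring_indexK ?groupM ?enum_valP // mulgA.
Qed.

(** The matrix permutes the basis by x |-> h x g, and its trace counts fixed points. *)
Lemma mxtrace_left_mult_regular h g : h \in G -> g \in G ->
  \tr (L h *m regular_repr K G g) = #|[set x in G | (h * x * g)%g == x]|%:R.
Proof.
move=> Gh Gg; rewrite /mxtrace -sum1dep_card natr_sum.
rewrite big_mkcondr /= (reindex (enum_val : 'I_#|G| -> gT)) /=; last first.
  by apply: (enum_val_bij_in (group1 G)).
rewrite [RHS](eq_bigl predT) => [|i]; last exact: enum_valP.
apply: eq_bigr => i _.
transitivity (row i (L h *m regular_repr K G g) 0 i); first by rewrite [RHS]mxE.
rewrite row_mul rowK -rowE rowK gring_indexK ?groupM ?enum_valP // mxE eqxx /=.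
rewrite -(can_in_eq (@gring_indexK _ G)) ?groupM ?enum_valP //.
by rewrite gring_valK eq_sym; case: eqP.
Qed.

(** The average [e] of the left multiplications by H commutes with G and has the balance relations
    as kernel, so the trace on the quotient is that of [e] followed by g. This counts the pairs (h,
    x) with h x g = x, in which x determines h = x g^-1 x^-1. *)
Lemma mxtrace_induced_triv g : g \in G ->
  \tr (induced sHG (triv_grepr K H) g)
    = #|H|%:R^-1 * #|[set x in G | (g ^ x^-1)%g \in H]|%:R.
Proof.
move=> Gg; pose T h := tprod (1%:M : 'M[K]_1) (L h).
pose e := #|H|%:R^-1 *: \sum_(h in H) T h.
have HG := subsetP sHG.
have Te h : h \in H -> T h *m e = e.
  move=> Hh; rewrite /e -scalemxAr mulmx_sumr; congr (_ *: _).
  rewrite [RHS](reindex_inj (mulIg h)) /=.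
  apply: eq_big => [k | k Hk]; first by rewrite groupMr.
  by rewrite -tprodE mulmx1 left_mult_mxM ?HG.
rewrite (@mxtrace_factmod _ _ _ _ _ _ e) //; first 1 last.
- have -> : 1%:M - e = #|H|%:R^-1 *: \sum_(h in H) (1%:M - T h).
    rewrite sumrB scalerBr sumr_const -scaler_nat scalerA mulVf ?scale1r //.
    exact: card_group_neq0.
  apply/scalemx_sub/summx_sub=> h Hh.
  by apply: (sumsmx_sup h) => //; rewrite /balance_mx tprod1.
- apply/sub_kermxP/sumsmx_subP=> h Hh; apply/sub_kermxP.
  by rewrite mulmxBl Te // tprod1 mul1mx subrr.
- rewrite /e -scalemxAl -scalemxAr mulmx_suml mulmx_sumr; congr (_ *: _).
  apply: eq_bigr => h Hh; rewrite -!tprodE !mulmx1; congr tprod.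
  exact: (left_mult_mxC _ sHG).
- rewrite /e -scalemxAl mxtraceZ mulmx_suml raddf_sum; congr (_ * _) => /=.
  rewrite (eq_bigr (fun h => #|[set x in G | (h * x * g)%g == x]|%:R)); last first.
    move=> h Hh; rewrite -tprodE mulmx1 mxtrace_prod mxtrace1 mul1r.
    exact: mxtrace_left_mult_regular (HG h Hh) Gg.
  rewrite -natr_sum -sum1dep_card; congr _%:R.
  rewrite (eq_bigr (fun h => \sum_(x in G | (h * x * g)%g == x) 1)%N); last first.
    by move=> h _; rewrite sum1dep_card.
  rewrite (exchange_big_dep (mem G)) => [|h x _ /andP[]//]; rewrite big_mkcondr /=.
  apply: eq_bigr => x Gx.
  have def_h h : ((h * x * g)%g == x) = (h == ((g ^ x^-1)%g)^-1%g).
    rewrite -conjVg conjgE invgK -(inj_eq (mulIg g^-1%g)) mulgK.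
    by rewrite -(inj_eq (mulIg x^-1%g)) mulgK mulgA.
  rewrite (eq_bigl (fun h => (h \in H) && (h == ((g ^ x^-1)%g)^-1%g))); last first.
    by move=> h; rewrite Gx def_h.
  have [Hgx | nHgx] := boolP (_ \in H).
    by rewrite (big_pred1 ((g ^ x^-1)%g)^-1%g) // => h; apply/andb_idl=> /eqP->; rewrite groupV.
  rewrite big_pred0 // => h; apply/negP=> /andP[Hh /eqP def]; case/negP: nHgx.
  by rewrite -groupV -def.
Qed.

End Induced.

Lemma mxtrace_conj (K : fieldType) (gT : finGroupType) (G : {group gT}) n
    (rG : mx_representation K G n) g x : g \in G -> x \in G ->
  \tr (rG (g ^ x)%g) = \tr (rG g).
Proof.
move=> Gg Gx; rewrite conjgE !repr_mxM ?groupM ?groupV // mxtrace_mulC.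
by rewrite -!mulmxA -repr_mxM ?groupV // mulgV repr_mx1 mulmx1.
Qed.

(* Frobenius reciprocity. *)
Lemma sum_mxtrace_induced_triv (K : numFieldType) (gT : finGroupType) (G H : {group gT})
    (sHG : H \subset G) (f : gT -> K) :
  (forall g x, g \in G -> x \in G -> f (g ^ x)%g = f g) ->
  #|H|%:R * \sum_(g in G) \tr (induced sHG (triv_grepr K H) g) * f g
    = #|G|%:R * \sum_(h in H) f h.
Proof.
move=> fJ; rewrite big_distrr /=.
transitivity (\sum_(g in G) \sum_(x in G | (g ^ x^-1)%g \in H) f g).
  apply: eq_bigr => g Gg; rewrite mxtrace_induced_triv //.
  rewrite !mulrA mulfV ?card_group_neq0 // mul1r sumr_const mulr_natl.
  by congr (_ *+ _); apply: eq_card => x; rewrite !inE.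
rewrite (exchange_big_dep (mem G)) => [|g x _ /andP[]//].
rewrite [RHS]mulr_natl -sumr_const; apply: eq_bigr => x; rewrite inE => Gx.
(* Conjugation by x carries H onto the range of the inner sum. *)
rewrite (reindex_inj (conjg_inj x)) /=; apply: eq_big => [h | h /andP[Ghx _]].
  by rewrite conjgK groupJr // Gx /=; apply/andb_idl/(subsetP sHG).
by rewrite fJ // -(groupJr h Gx).
Qed.

(** Any function of [chi] is a class function. Both sums needed below, of chi^(k+1) and of chi (chi
    - 1)^k, have this shape. *)
Corollary sum_induced_triv_comp (K : numFieldType) (gT : finGroupType)
    (G H : {group gT}) (sHG : H \subset G) (phi : K -> K) :
  let chi g := \tr (induced sHG (triv_grepr K H) g) in
  #|H|%:R * \sum_(g in G) chi g * phi (chi g)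
    = #|G|%:R * \sum_(h in H) phi (chi h).
Proof.
move=> chi; apply: (sum_mxtrace_induced_triv sHG (f := phi \o chi)) => g x Gg Gx.
by rewrite /comp /chi (mxtrace_conj (induced sHG (triv_grepr K H)) Gg Gx).
Qed.

(** * Counting in GL_2 by the second row *)

Lemma det_mx22 (R : comNzRingType) (A : 'M[R]_2) :
  \det A = A 0 0 * A 1 1 - A 0 1 * A 1 0.
Proof.
have E1 : lift 0 (0 : 'I_1) = 1 :> 'I_2 by apply: val_inj.
have E0 : lift (1 : 'I_2) (0 : 'I_1) = 0 by apply: val_inj.
rewrite (expand_det_row A 0) big_ord_recl big_ord1 E1 /cofactor !det_mx11 !mxE.
by rewrite !E1 !E0 !expr1 expr0 mul1r mulN1r mulrN.
Qed.

Section GL2Sums.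

Variable F : finFieldType.
Implicit Types (x : {'GL_2[F]}) (a b c d : F).

Definition mx22 a b c d : 'M[F]_2 :=
  \matrix_(i, j) if i == 0 then if j == 0 then a else b
                 else if j == 0 then c else d.

(** The second row comes outermost because it alone decides whether x lies in B and, for fixed b in
    B, whether x b x^-1 does. *)
Lemma sum_GL2 (V : nmodType) (f : F -> F -> F -> F -> V) :
  \sum_(x : {'GL_2[F]}) f (GLval x 0 0) (GLval x 0 1) (GLval x 1 0) (GLval x 1 1)
    = \sum_c \sum_d \sum_a \sum_(b | a * d - b * c != 0) f a b c d.
Proof.
under [RHS]eq_bigr => c _ do under eq_bigr => d _ do
  rewrite (pair_big_dep predT (fun a b => a * d - b * c != 0)
             (fun a b => f a b c d)) /=.
rewrite pair_bigA /= pair_big_dep /=.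
pose h x := ((GLval x 1 0, GLval x 1 1), (GLval x 0 0, GLval x 0 1)).
(* The default value is only reached at singular matrices, which the range of summation excludes. *)
pose g (u : (F * F) * (F * F)) : {'GL_2[F]} :=
  insubd (1%g : {'GL_2[F]}) (mx22 u.2.1 u.2.2 u.1.1 u.1.2).
rewrite [RHS](reindex h) /=.
  by apply: eq_bigl => x; rewrite -det_mx22; exact: (esym (GL_det x)).
exists g => [x _ | u /= det_u].
  apply: val_inj; rewrite /g /h /= val_insubd.
  have -> : mx22 (GLval x 0 0) (GLval x 0 1) (GLval x 1 0) (GLval x 1 1) = GLval x.
    apply/matrixP=> i j; rewrite mxE.
    by case: i => [[|[]]] //= ?; case: j => [[|[]]] //= ?;
      congr (GLval x _ _); apply: val_inj.
  by rewrite GL_unitmx.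
have gu : GLval (g u) = mx22 u.2.1 u.2.2 u.1.1 u.1.2.
  by apply: insubdK; rewrite -topredE /= unitmxE unitfE det_mx22 !mxE.
by rewrite /h gu !mxE; case: u {det_u gu} => [[]] ? ? [].
Qed.

(** If c != 0, each a excludes the single value b = a d / c; if c = 0, the condition is a != 0 and b
    is free. *)
Lemma sum_affine_neq0 c d : (c, d) != (0, 0) ->
  (\sum_a \sum_(b | (a * d - b * c)%R != 0%R) 1 = #|F| * #|F|.-1)%N.
Proof.
have [-> | nz_c] := eqVneq c 0; last first.
  move=> _; rewrite (eq_bigr (fun _ => #|F|.-1)) ?sum_nat_const // => a _.
  rewrite -(cardC1 (a * d / c)) -sum1_card; apply: eq_bigl => b.
  by rewrite !inE subr_eq0 eq_sym -(can2_eq (mulfK nz_c) (divfK nz_c)).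
rewrite xpair_eqE eqxx /= => nz_d.
rewrite (bigID (pred1 0)) /= big_pred1_eq big1 => [|b]; last first.
  by rewrite mul0r mulr0 subrr eqxx.
rewrite add0n (eq_bigr (fun _ => #|F|)) => [|a nz_a]; last first.
  rewrite -sum1_card; apply: eq_bigl => b.
  by rewrite mulr0 subr0 mulf_neq0.
by rewrite sum_nat_const (cardC1 0) mulnC.
Qed.

Lemma card_GL2_row (P : F -> F -> bool) :
  #|[set x : {'GL_2[F]} | P (GLval x 1 0) (GLval x 1 1)]|
  = (#|F| * #|F|.-1 * \sum_c \sum_(d | ((c, d) != (0%R, 0%R)) && P c d) 1)%N.
Proof.
rewrite -sum1dep_card big_mkcond /=.
have /= -> := sum_GL2 (fun _ _ c d => if P c d then 1%N else 0%N).
rewrite big_distrr /=; apply: eq_bigr => c _.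
rewrite big_distrr [RHS]big_mkcond /=; apply: eq_bigr => d _.
rewrite muln1; case: eqVneq => [[-> ->] | nz_cd] /=.
  apply: big1 => a _; apply: big_pred0 => b.
  by rewrite !mulr0 subrr eqxx.
case: (P c d); last by rewrite big1 // => a _; rewrite big1.
exact: sum_affine_neq0.
Qed.

Lemma borelE x : (x \in borel F) = (GLval x 1 0 == 0).
Proof. by rewrite inE; congr (GLval x _ _ == _); apply: val_inj. Qed.

Lemma sum_neq0 (n : nat) : (\sum_(a : F | a != 0%R) n = #|F|.-1 * n)%N.
Proof. by rewrite sum_nat_const (cardC1 0). Qed.

Lemma card_borel : #|borel F| = (#|F| * #|F|.-1 * #|F|.-1)%N.
Proof.
transitivity #|[set x : {'GL_2[F]} | GLval x 1 0 == 0]|.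
  by apply: eq_card => x; rewrite borelE inE.
rewrite (card_GL2_row (fun c _ => c == 0)); congr (_ * _)%N.
rewrite (bigD1 0) //= [X in (_ + X)%N]big1 => [|c nz_c]; last first.
  by apply: big_pred0 => d; rewrite (negPf nz_c) andbF.
rewrite addn0 -[RHS]muln1 -sum_neq0; apply: eq_bigl => d.
by rewrite xpair_eqE eqxx andbT.
Qed.

(** The right-hand side says that the second row (c, d) of x is a left eigenvector of b: the
    expression is, up to sign, the determinant with rows (c, d) and (c, d) b. *)
Lemma conj_borel (b x : {'GL_2[F]}) : b \in borel F ->
  ((b ^ x^-1)%g \in borel F) =
  (GLval x 1 0 * (GLval x 1 1 * (GLval b 0 0 - GLval b 1 1)
                  - GLval x 1 0 * GLval b 0 1) == 0).
Proof.
rewrite !borelE => /eqP b10.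
have : GLval (b ^ x^-1)%g *m GLval x = GLval x *m GLval b.
  by rewrite -!GL_MxE conjgE invgK mulgA mulgKV.
move: (b ^ x^-1)%g => c cx.
have entry (A B : 'M[F]_2) i j : (A *m B) i j = A i 0 * B 0 j + A i 1 * B 1 j.
  have E1 : lift 0 (0 : 'I_1) = 1 :> 'I_2 by apply: val_inj.
  by rewrite mxE big_ord_recl big_ord1 E1.
have E0 := congr1 (fun A : 'M[F]_2 => A 1 0) cx.
have E1 := congr1 (fun A : 'M[F]_2 => A 1 1) cx.
rewrite !entry b10 mulr0 addr0 in E0; rewrite !entry in E1.
have nz_x : GLval x 0 0 * GLval x 1 1 - GLval x 0 1 * GLval x 1 0 != 0.
  by rewrite -det_mx22; exact: (GL_det x).
(* Multiplied by det x, the lower left entry of the conjugate becomes a determinant in the second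
   rows of c x = x b and of x. *)
rewrite -(inj_eq (mulIf nz_x)) mul0r; congr (_ == 0).
move: E0 E1; move: (GLval x) (GLval b) (GLval c) => X B C E0 E1.
transitivity ((C 1 0 * X 0 0 + C 1 1 * X 1 0) * X 1 1
              - (C 1 0 * X 0 1 + C 1 1 * X 1 1) * X 1 0); first by ring.
by rewrite E0 E1; ring.
Qed.

(** The second factor counts the fixed points of b on the projective line. The line c = 0 is always
    fixed; for each c != 0 the equation d (b00 - b11) = c b01 is solved by every d, by none or by
    exactly one. *)
Lemma card_conj_borel (b : {'GL_2[F]}) : b \in borel F ->
  #|[set x in 'GL_2[F]%g | (b ^ x^-1)%g \in borel F]|
  = (#|borel F| * (if GLval b 0%R 0%R == GLval b 1%R 1%R then
                     if GLval b 0%R 1%R == 0%R then #|F|.+1 else 1 else 2))%N.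
Proof.
move=> Bb; pose P c d := c * (d * (GLval b 0 0 - GLval b 1 1) - c * GLval b 0 1) == 0.
transitivity #|[set x : {'GL_2[F]} | P (GLval x 1 0) (GLval x 1 1)]|.
  apply: eq_card => x; have Gx : x \in 'GL_2[F]%g by rewrite inE.
  by rewrite in_set [RHS]in_set Gx conj_borel.
rewrite card_GL2_row card_borel -!mulnA; do 2!congr (_ * _)%N.
rewrite (bigD1 0) //=.
have -> : (\sum_(d : F | ((0%R : F, d) != (0%R, 0%R)) && P 0%R d) 1 = #|F|.-1)%N.
  rewrite -[RHS]muln1 -sum_neq0; apply: eq_bigl => d.
  by rewrite xpair_eqE eqxx /P mul0r eqxx andbT.
rewrite (eq_bigr (fun _ => if GLval b 0 0 == GLval b 1 1 then
                     if GLval b 0 1 == 0 then #|F| else 0%N else 1%N)).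
  rewrite sum_neq0; case: ifP => _; last by rewrite muln1 muln2 addnn.
  by case: ifP => _; rewrite ?mulnS ?muln0 ?muln1 ?addn0.
move=> c nz_c; rewrite (eq_bigl (P c)) => [|d]; last by rewrite xpair_eqE (negPf nz_c).
have [eq_b | neq_b] := eqVneq (GLval b 0 0) (GLval b 1 1).
  case: eqVneq => [b01 | nz_b01].
    rewrite -[RHS]sum1_card; apply: eq_bigl => d.
    by rewrite /P eq_b b01 subrr !mulr0 subr0 mulr0 eqxx.
  apply: big_pred0 => d.
  by rewrite /P eq_b subrr mulr0 sub0r mulrN oppr_eq0 !mulf_eq0 (negPf nz_c) (negPf nz_b01).
rewrite -subr_eq0 in neq_b.
rewrite (big_pred1 (c * GLval b 0 1 / (GLval b 0 0 - GLval b 1 1))) // => d.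
by rewrite /P mulf_eq0 (negPf nz_c) subr_eq0 (can2_eq (mulfK neq_b) (divfK neq_b)).
Qed.

End GL2Sums.

(** * The character on B and the resulting identities for dimensions *)

Section BorelCharacter.

Variables (K : numFieldType) (F : finFieldType).
Local Notation V := (borel_induced K F).

Lemma mxtrace_borel_induced (b : {'GL_2[F]}) : b \in borel F ->
  \tr (V b) = (if GLval b 0 0 == GLval b 1 1 then
                 if GLval b 0 1 == 0 then #|F|.+1 else 1%N else 2)%:R.
Proof.
move=> Bb; rewrite mxtrace_induced_triv ?inE // card_conj_borel // natrM mulKf //.
exact: card_group_neq0.
Qed.

(** For each lower right entry d, B contains one scalar matrix, q - 1 nonscalar ones with a = d, and
    (q - 2) q with a outside {0, d}. *)
Lemma sum_borel_induced (f : K -> K) :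
  \sum_(b in borel F) f (\tr (V b))
    = (f #|F|.+1%:R + f 1 *+ #|F|.-1 + f 2 *+ (#|F|.-2 * #|F|)) *+ #|F|.-1.
Proof.
pose h (a b c d : F) : K := f (if a == d then if b == 0 then #|F|.+1 else 1%N else 2)%:R.
transitivity (\sum_(x : {'GL_2[F]}) if GLval x 1 0 == 0 then
   h (GLval x 0 0) (GLval x 0 1) (GLval x 1 0) (GLval x 1 1) else 0).
  rewrite -big_mkcond /=; apply: eq_big => [x | x Bx]; first by rewrite borelE.
  by rewrite mxtrace_borel_induced.
rewrite (sum_GL2 (fun a b c d => if c == 0 then h a b c d else 0)).
rewrite (bigD1 0) //= [X in _ + X]big1 => [|c nz_c]; last first.
  by rewrite (negPf nz_c); do 2!(apply: big1 => ? _); apply: big1.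
rewrite addr0 eqxx (bigID (pred1 0)) /= big_pred1_eq big1 => [|a _]; last first.
  by apply: big_pred0 => b; rewrite !mulr0 subrr eqxx.
rewrite add0r; set S := _ + _ + _.
rewrite -(cardC1 (0 : F)) -sumr_const; apply: eq_big => // d nz_d; rewrite {}/S.
rewrite (bigID (pred1 0)) /= big_pred1_eq big_pred0 => [|b]; last first.
  by rewrite mul0r mulr0 subrr eqxx.
rewrite add0r (bigD1 d) //=; congr (_ + _).
  rewrite (eq_bigl predT) => [|b]; last by rewrite mulr0 subr0 mulf_neq0.
  rewrite (bigD1 0) //= /h !eqxx; congr (_ + _).
  rewrite -(cardC1 (0 : F)) -sumr_const; apply: eq_big => // b nz_b.
  by rewrite (negPf nz_b).
have -> : #|F|.-2 = #|predC (mem [:: 0; d])|.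
  have := cardC (mem [:: 0; d]); rewrite (card_uniqP _) /= ?inE ?andbT 1?eq_sym //.
  by move=> <-.
rewrite mulnC mulrnA -sumr_const; apply: eq_big => [a | a /andP[nz_a neq_ad]].
  by rewrite !inE negb_or.
rewrite -sumr_const; apply: eq_big => [b | b _].
  by rewrite mulr0 subr0 mulf_neq0.
by rewrite /h (negPf neq_ad).
Qed.

Local Notation G := 'GL_2[F]%g.

Lemma natr_card_borel : #|borel F|%:R = #|F|%:R * #|F|.-1%:R * #|F|.-1%:R :> K.
Proof. by rewrite card_borel !natrM. Qed.

Lemma card_pred_neq0 : #|F|.-1%:R != 0 :> K.
Proof. by rewrite pnatr_eq0 -lt0n -subn1 subn_gt0 card_finNzRing_gt1. Qed.

(** Reciprocity with phi(z) = z^k; a factor q - 1 cancels between |B| = q (q - 1)^2 and the sum over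
    B. *)
Lemma tensor_inv_dim_borel_induced k :
  (#|F| * #|F|.-1 * tensor_inv_dim V k.+1
    = #|F|.+1 ^ k + #|F|.-1 + #|F|.-2 * #|F| * 2 ^ k)%N.
Proof.
apply/eqP; rewrite -(eqr_nat K) -(inj_eq (mulIf card_pred_neq0)); apply/eqP.
rewrite !natrM mulrAC -natr_card_borel.
apply: (mulfI (card_group_neq0 K G)).
rewrite mulrCA tensor_inv_dimE.
under eq_bigr do rewrite exprS.
rewrite (sum_induced_triv_comp _ (fun z => z ^+ k)).
rewrite (sum_borel_induced (fun z => z ^+ k)) expr1n; congr (_ * _).
by rewrite -[_ *+ _ as X in X = _]mulr_natr !natrD !natrM !natrX; ring.
Qed.

(** Reciprocity with phi(z) = (z - 1)^k, as [chi - 1] takes the values q, 0 and 1 on B. The power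
    [0 ^ k] survives only at k = 0, where it is 1. *)
Lemma tensor_inv_dim_steinberg (Vq : representation K G) k : is_steinberg Vq ->
  (#|F| * #|F|.-1 * (tensor_inv_dim Vq k.+1 + tensor_inv_dim Vq k)
    = #|F| ^ k + #|F|.-1 * 0 ^ k + #|F|.-2 * #|F|)%N.
Proof.
move=> stVq.
have trVq g : g \in G -> \tr (Vq g) = \tr (V g) - 1.
  move=> Gg; rewrite (mxtrace_rsim stVq Gg) /= mxtrace_block mxtrace1.
  by rewrite addrC addKr.
apply/eqP; rewrite -(eqr_nat K) -(inj_eq (mulIf card_pred_neq0)); apply/eqP.
rewrite !natrM mulrAC -natr_card_borel.
apply: (mulfI (card_group_neq0 K G)).
rewrite mulrCA natrD mulrDr !tensor_inv_dimE -big_split /=.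
rewrite (eq_bigr (fun g => \tr (V g) * (\tr (V g) - 1) ^+ k)) => [|g Gg]; last first.
  by rewrite trVq // exprS; ring.
rewrite (sum_induced_triv_comp _ (fun z => (z - 1) ^+ k)).
rewrite (sum_borel_induced (fun z => (z - 1) ^+ k)); congr (_ * _).
have -> : #|F|.+1%:R - 1 = #|F|%:R :> K by rewrite -natr1 addrK.
have -> : 2 - 1 = 1 :> K by ring.
rewrite subrr expr1n !natrD !natrM !natrX; ring.
Qed.

End BorelCharacter.

(** * Power series with cubic numerator and denominator *)

(** Comparison of coefficients. The recurrence is required only from [f 1] on, which leaves [f 0]
    free to be exceptional; it last enters in degree 3. *)
Lemma cubic_fps_eq_frac (K : fieldType) (f : nat -> K) (p0 p1 p2 p3 q1 q2 q3 : K) :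
    f 0 = p0 -> f 1 + q1 * f 0 = p1 -> f 2 + q1 * f 1 + q2 * f 0 = p2 ->
    f 3 + q1 * f 2 + q2 * f 1 + q3 * f 0 = p3 ->
    (forall n, f n.+4 + q1 * f n.+3 + q2 * f n.+2 + q3 * f n.+1 = 0) ->
  fps_eq_frac f (p0%:P + p1 *: 'X + p2 *: 'X^2 + p3 *: 'X^3)
    (1 + q1 *: 'X + q2 *: 'X^2 + q3 *: 'X^3).
Proof.
move=> def_p0 def_p1 def_p2 def_p3 rec_f; set p := (p in fps_eq_frac _ p _).
set q := (q in fps_eq_frac _ _ q).
have [q_0 q_1 q_2 q_3] : [/\ q`_0 = 1, q`_1 = q1, q`_2 = q2 & q`_3 = q3].
  by split; rewrite /q !coefE /= !(mulr0, mulr1, addr0, add0r).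
have q_4 m : q`_m.+4 = 0 by rewrite /q !coefE /= !(mulr0, addr0).
split=> [|n]; first by rewrite q_0 oner_eq0.
rewrite /fps_mul; case: n => [|[|[|[|n]]]].
- by rewrite big_ord1 q_0 def_p0 /p !coefE /=; ring.
- rewrite !big_ord_recr big_ord0 /= q_0 q_1 /p !coefE /= -def_p1; ring.
- rewrite !big_ord_recr big_ord0 /= q_0 q_1 q_2 /p !coefE /= -def_p2; ring.
- rewrite !big_ord_recr big_ord0 /= q_0 q_1 q_2 q_3 /p !coefE /= -def_p3; ring.
have -> : p`_n.+4 = 0 by rewrite /p !coefE /= !(mulr0, addr0).
rewrite !big_ord_recr /= big1 => [|i _]; last first.
  by rewrite -[n.+4]/(4 + n)%N -addnBA ?q_4 ?mulr0 // ltnW.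
rewrite !subSS subnn -[n.+4]/(4 + n)%N -[n.+3]/(3 + n)%N -[n.+2]/(2 + n)%N.
rewrite -[n.+1]/(1 + n)%N !addnK q_0 q_1 q_2 q_3 q_4 -[RHS](rec_f n) /=; ring.
Qed.

(** * Closed forms and Poincare series *)

Section ClosedForms.

Variables (F : finFieldType) (K : numFieldType).
Local Notation Q := (#|F|%:R : rat).
Local Notation V := (borel_induced K F).

Let Q_gt1 : 1 < Q. Proof. by rewrite ltr1n card_finNzRing_gt1. Qed.
Let Q_neq0 : Q != 0. Proof. exact: lt0r_neq0 (lt_trans ltr01 Q_gt1). Qed.
Let Q_subr1_neq0 : Q - 1 != 0. Proof. by rewrite lt0r_neq0 // subr_gt0. Qed.
Let Q_addr1_neq0 : Q + 1 != 0.
Proof. exact: lt0r_neq0 (addr_gt0 (lt_trans ltr01 Q_gt1) ltr01). Qed.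
Let Q_sqr_subr1_neq0 : Q ^+ 2 - 1 != 0.
Proof. by rewrite subr_sqr_1 mulf_neq0. Qed.

Let natr_pred1 : #|F|.-1%:R = Q - 1.
Proof. by rewrite -subn1 natrB // ltnW ?card_finNzRing_gt1. Qed.
Let natr_pred2 : #|F|.-2%:R = Q - 2.
Proof. by rewrite -subn2 natrB // card_finNzRing_gt1. Qed.

Lemma tensor_inv_dim_borel_inducedE k :
  (tensor_inv_dim V k.+1)%:R =
    1 / (Q * (Q - 1)) * ((Q + 1) ^+ k + Q * (Q - 2) * 2 ^+ k + Q - 1).
Proof.
have := congr1 (fun n => n%:R : rat) (tensor_inv_dim_borel_induced K F k).
rewrite !(natrM, natrD, natrX) natr_pred1 natr_pred2 -natr1 => def_dim.
apply: (mulfI (mulf_neq0 Q_neq0 Q_subr1_neq0)); rewrite def_dim.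
by field; rewrite Q_subr1_neq0.
Qed.

Lemma tensor_inv_dim0 (gT : finGroupType) (G : {group gT}) (U : representation K G) :
  tensor_inv_dim U 0 = 1%N.
Proof.
apply/eqP; rewrite -(eqr_nat K); apply/eqP/(mulfI (card_group_neq0 K G)).
by rewrite tensor_inv_dimE mulr1 sumr_const.
Qed.

Lemma poincare_borel_induced :
  fps_eq_frac (poincare_series V)
    (1 - (Q + 3) *: 'X + (2 * Q + 3) *: 'X^2 - Q *: 'X^3)
    ((1 - 'X) * (1 - 2 *: 'X) * (1 - (1 + Q) *: 'X)).
Proof.
have -> : 1 - (Q + 3) *: 'X + (2 * Q + 3) *: 'X^2 - Q *: 'X^3
  = 1%:P + (- (Q + 3)) *: 'X + (2 * Q + 3) *: 'X^2 + (- Q) *: 'X^3.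
  by rewrite !scaleNr.
(* The inverse roots 1, 2 and q + 1 are the ratios in the closed form, so the expanded coefficients
   give its recurrence. *)
have -> : (1 - 'X) * (1 - 2 *: 'X) * (1 - (1 + Q) *: 'X)
  = 1 + (- (4 + Q)) *: 'X + (5 + 3 * Q) *: 'X^2 + (- (2 * (1 + Q))) *: 'X^3.
  by rewrite -!mul_polyC !(polyCN, polyCD, polyCM, polyC1); ring.
apply: cubic_fps_eq_frac => [||||n]; rewrite /poincare_series;
  rewrite ?tensor_inv_dim_borel_inducedE ?tensor_inv_dim0 ?exprS.
- by [].
- by field; rewrite Q_subr1_neq0.
- by field; rewrite Q_subr1_neq0.
- by field; rewrite Q_subr1_neq0.
- by field; rewrite Q_subr1_neq0.
Qed.

Section Steinberg.

Variable Vq : representation K 'GL_2[F]%G.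
Hypothesis stVq : is_steinberg Vq.

(** Solves d(k+1) + d(k) = (q^k + (q - 2) q) / (q (q - 1)) for k >= 1. The alternating term is the
    homogeneous solution, with coefficient fixed by d(1) = 0. *)
Lemma tensor_inv_dim_steinbergE k :
  (tensor_inv_dim Vq k.+1)%:R =
    1 / (2 * (Q ^+ 2 - 1)) *
    (2 * Q ^+ k - Q * (Q - 1) * (-1) ^+ k + (Q + 1) * (Q - 2)).
Proof.
elim: k => [|k IHk];
  have := congr1 (fun n => n%:R : rat) (tensor_inv_dim_steinberg _ stVq).
  move/(_ 0%N); rewrite tensor_inv_dim0.
  rewrite !(natrM, natrD, natrX) natr_pred1 natr_pred2 !expr0 => def_dim.
  (* At k = 0 the right side of the recursion is q (q - 1), so d(1) + d(0) = 1, while d(0) = 1. *)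
  have -> : (tensor_inv_dim Vq 1)%:R = 0 :> rat.
    apply: (mulfI (mulf_neq0 Q_neq0 Q_subr1_neq0)); apply: (addIr (Q * (Q - 1))).
    by rewrite -{2}[Q * (Q - 1)]mulr1 -mulrDr def_dim; ring.
  by field.
move/(_ k.+1).
rewrite !(natrM, natrD, natrX) natr_pred1 natr_pred2 expr0n mulr0 addr0 IHk => def_dim.
set a := (tensor_inv_dim _ _)%:R in def_dim *.
have {def_dim} -> : a = (Q ^+ k.+1 + (Q - 2) * Q) / (Q * (Q - 1))
   - 1 / (2 * (Q ^+ 2 - 1)) *
     (2 * Q ^+ k - Q * (Q - 1) * (-1) ^+ k + (Q + 1) * (Q - 2)).
  by rewrite -def_dim; field; rewrite Q_subr1_neq0 Q_neq0 Q_sqr_subr1_neq0.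
by rewrite !exprS; field; rewrite Q_subr1_neq0 Q_neq0 Q_sqr_subr1_neq0.
Qed.

Lemma tensor_inv_dim_steinberg_odd l :
  (tensor_inv_dim Vq (2 * l + 1))%:R = (Q ^+ (2 * l) - 1) / (Q ^+ 2 - 1).
Proof.
rewrite addn1 tensor_inv_dim_steinbergE !exprM sqrrN !expr1n.
by move: ((Q ^+ 2) ^+ l) => P; field.
Qed.

Lemma tensor_inv_dim_steinberg_even l : (1 <= l)%N ->
  (tensor_inv_dim Vq (2 * l))%:R =
    1 + Q * ((Q ^+ (2 * l - 2) - 1) / (Q ^+ 2 - 1)).
Proof.
(* With l now the predecessor, the exponent k - 1 is 2 l + 1, so the sign is -1. *)
case: l => // l _; rewrite mulnS addKn addnC addn2.
by rewrite tensor_inv_dim_steinbergE !exprS !exprM sqrrN !expr1n; field.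
Qed.

Lemma sum_geometric_sqr l :
  (\sum_(0 <= j < l) #|F| ^ (2 * j))%:R = (Q ^+ (2 * l) - 1) / (Q ^+ 2 - 1).
Proof.
elim: l => [|l IHl]; first by rewrite big_geq // subrr mul0r.
by rewrite big_nat_recr //= natrD IHl natrX mulnS exprD; field.
Qed.

Lemma tensor_inv_dim_steinberg_odd_sum l :
  tensor_inv_dim Vq (2 * l + 1) = (\sum_(0 <= j < l) #|F| ^ (2 * j))%N.
Proof.
apply/eqP; rewrite -(eqr_nat rat) sum_geometric_sqr.
by rewrite tensor_inv_dim_steinberg_odd.
Qed.

Lemma tensor_inv_dim_steinberg_even_sum l : (1 <= l)%N ->
  tensor_inv_dim Vq (2 * l) = (1 + \sum_(0 <= j < l - 1) #|F| ^ (2 * j + 1))%N.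
Proof.
move=> l_gt0; apply/eqP; rewrite -(eqr_nat rat) tensor_inv_dim_steinberg_even //.
have -> : (\sum_(0 <= j < l - 1) #|F| ^ (2 * j + 1)
           = #|F| * \sum_(0 <= j < l - 1) #|F| ^ (2 * j))%N.
  by rewrite big_distrr; apply: eq_bigr => j _; rewrite addn1 expnS.
by rewrite natrD natrM sum_geometric_sqr mulnBr.
Qed.

Lemma poincare_steinberg :
  fps_eq_frac (poincare_series Vq)
    (1 - Q *: 'X + 'X^3) ((1 - 'X) * (1 + 'X) * (1 - Q *: 'X)).
Proof.
have -> : 1 - Q *: 'X + 'X^3 = 1%:P + (- Q) *: 'X + 0 *: 'X^2 + 1 *: 'X^3 :> {poly rat}.
  by rewrite scaleNr scale0r scale1r addr0.
have -> : (1 - 'X) * (1 + 'X) * (1 - Q *: 'X)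
  = 1 + (- Q) *: 'X + (-1) *: 'X^2 + Q *: 'X^3.
  by rewrite -!mul_polyC !(polyCN, polyC1); ring.
apply: cubic_fps_eq_frac => [||||n]; rewrite /poincare_series;
  rewrite ?tensor_inv_dim_steinbergE ?tensor_inv_dim0 ?exprS.
- by [].
- by field.
- by field.
- by field.
- by field.
Qed.

End Steinberg.

End ClosedForms.

Theorem theorem5p3 (R : realType) (F : finFieldType) (q : nat)
    (card_F : #|F| = q) (q_odd : odd q) :
  let V := borel_induced R[i] F in
  (* (a) *)
  [/\ tensor_inv_dim V 0 = 1%N,
      (forall k : nat, (1 <= k)%N ->
         (tensor_inv_dim V k)%:R =
           1 / (q%:R * (q%:R - 1)) *
           ((q%:R + 1) ^+ (k - 1) + q%:R * (q%:R - 2) * 2 ^+ (k - 1)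
            + q%:R - 1) :> rat)
    & fps_eq_frac (poincare_series V)
        (1 - (q%:R + 3) *: 'X + (2 * q%:R + 3) *: 'X^2 - q%:R *: 'X^3)
        ((1 - 'X) * (1 - 2 *: 'X) * (1 - (1 + q%:R) *: 'X))] /\
  (* (b) *)
  (forall Vq : representation R[i] 'GL_2[F]%G, is_steinberg Vq ->
   [/\ tensor_inv_dim Vq 0 = 1%N,
       (forall k : nat, (1 <= k)%N ->
          (tensor_inv_dim Vq k)%:R =
            1 / (2 * (q%:R ^+ 2 - 1)) *
            (2 * q%:R ^+ (k - 1) - q%:R * (q%:R - 1) * (-1) ^+ (k - 1)
             + (q%:R + 1) * (q%:R - 2)) :> rat),
       (forall l : nat,
          (tensor_inv_dim Vq (2 * l + 1))%:R =
            (q%:R ^+ (2 * l) - 1) / (q%:R ^+ 2 - 1) :> rat /\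
          tensor_inv_dim Vq (2 * l + 1) = (\sum_(0 <= j < l) q ^ (2 * j))%N),
       (forall l : nat, (1 <= l)%N ->
          (tensor_inv_dim Vq (2 * l))%:R =
            1 + q%:R * ((q%:R ^+ (2 * l - 2) - 1) / (q%:R ^+ 2 - 1)) :> rat /\
          tensor_inv_dim Vq (2 * l) =
            (1 + \sum_(0 <= j < l - 1) q ^ (2 * j + 1))%N)
     & fps_eq_frac (poincare_series Vq)
         (1 - q%:R *: 'X + 'X^3)
         ((1 - 'X) * (1 + 'X) * (1 - q%:R *: 'X))]).
Proof.
case: _ / card_F => V; split=> [|Vq stVq]; split.
- exact: tensor_inv_dim0.
- by case=> // k _; rewrite subn1 tensor_inv_dim_borel_inducedE.
- exact: poincare_borel_induced.
- exact: tensor_inv_dim0.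
- by case=> // k _; rewrite subn1 (tensor_inv_dim_steinbergE stVq).
- move=> l; split; first exact: tensor_inv_dim_steinberg_odd.
  exact: tensor_inv_dim_steinberg_odd_sum.
- move=> l l_gt0; split; first exact: tensor_inv_dim_steinberg_even.
  exact: tensor_inv_dim_steinberg_even_sum.
- exact: poincare_steinberg.
Qed.
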